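(* Let $N\ge 2$, let $\{(x_i,y_i,d_i): i=1,2,\dots,N\}$ be real data with $x_1<x_2<\dots<x_N$, let $I=[x_1,x_N]$ and $J=\{1,\dots,N-1\}$. For $i\in J$ let $L_i(x)=a_ix+b_i$ be the affine map with $L_i(x_1)=x_i$, $L_i(x_N)=x_{i+1}$. Let $0\le\kappa<1$, let $\alpha_i$ $(i\in J)$ be real scaling factors with $|\alpha_i|\le\kappa a_i$, and let $Q_i$ $(i\in J)$ be preassigned quadratic polynomials (given by a choice of shape parameters) with $Q_i(x)\neq 0$ for all $x\in I$. Consider maps of the form $$F_i(x,y)=\alpha_i y+R_i(x),\qquad R_i(x)=\frac{P_i(x)}{Q_i(x)},\qquad F_{i,1}(x,y)=\frac{\alpha_i y+R_i^{(1)}(x)}{a_i},\qquad i\in J,$$ where $P_i$ is a cubic polynomial, required to satisfy, for all $i\in J$, $$F_i(x_1,y_1)=y_i,\quad F_i(x_N,y_N)=y_{i+1},\quad F_{i,1}(x_1,d_1)=d_i,\quad F_{i,1}(x_N,d_N)=d_{i+1}.$$ Then a $\mathcal{C}^1$-rational cubic spline fractal interpolation function $S$ associated with such maps, satisfying $S(x_i)=y_i$ and $S^{(1)}(x_i)=d_i$ for $i=1,2,\dots,N$, exists, and it is unique for a fixed choice of the shape parameters (i.e. of the $Q_i$) and the scaling factors $\alpha_i$.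
   Context: A $\mathcal{C}^1$-rational cubic spline fractal interpolation function (FIF) associated with the iterated function system $\{(L_i(x),F_i(x,y)): i\in J\}$ is a function $S\in\mathcal{C}^1(I)$ satisfying the functional equation $S(L_i(x))=F_i(x,S(x))=\alpha_iS(x)+R_i(x)$ for all $x\in I$, $i\in J$ (equivalently, the graph of $S$ is the attractor of the maps $(x,y)\mapsto (L_i(x),F_i(x,y))$). Here ''quadratic polynomial'' and ''cubic polynomial'' mean polynomial of degree at most $2$, respectively at most $3$. The superscript $(1)$ denotes the first derivative. In the paper the denominators are parametrized by shape parameters $r_i>-1$ via $Q_i(x)=1+(r_i-3)\theta(1-\theta)$, $\theta=\frac{x-x_1}{x_N-x_1}$. *)

(* Defs.v *)
From HB Require Import structures.
From mathcomp Require Import all_boot all_order all_algebra.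
From mathcomp Require Import all_classical all_reals all_analysis.
Set Implicit Arguments.
Unset Strict Implicit.
Unset Printing Implicit Defensive.
Import Order.TTheory GRing.Theory Num.Theory.
Import numFieldNormedType.Exports.
Local Open Scope classical_set_scope.
Local Open Scope ring_scope.

(* Derivative relative to A: the difference quotient is taken over points of A
   only, hence one-sided at the endpoints when A is a segment. *)
Definition has_deriv_within (R : realType) (A : set R) (f : R -> R) (t l : R)
    : Prop :=
  (f z - f t) / (z - t) @[z --> within A t^'] --> l.

Definition C1_on (R : realType) (A : set R) (f : R -> R) : Prop :=
  exists2 f1 : R -> R,
    (forall t, A t -> has_deriv_within A f t (f1 t)) &
    {within A, continuous f1}.

Definition affine_map (R : realType) (a b t : R) : R := a * t + b.

Definition ratfun (R : realType) (P Q : {poly R}) (t : R) : R := P.[t] / Q.[t].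

Definition ifs_F (R : realType) (alpha : R) (r : R -> R) (t u : R) : R :=
  alpha * u + r t.

Definition ifs_F1 (R : realType) (a alpha : R) (r : R -> R) (t u : R) : R :=
  (alpha * u + derive1 r t) / a.

(* The data x, y, d are indexed by 1, ..., N and the maps by 1, ..., N - 1;
   other values of the sequences are irrelevant. *)
Definition join_up (R : realType) (N : nat) (x y d a alpha : nat -> R)
    (Q P : nat -> {poly R}) : Prop :=
  forall i, (1 <= i < N)%N ->
    let F := ifs_F (alpha i) (ratfun (P i) (Q i)) in
    let F1 := ifs_F1 (a i) (alpha i) (ratfun (P i) (Q i)) in
    [/\ F (x 1%N) (y 1%N) = y i, F (x N) (y N) = y i.+1,
        F1 (x 1%N) (d 1%N) = d i & F1 (x N) (d N) = d i.+1].

Definition is_C1_FIF (R : realType) (N : nat) (x a b alpha : nat -> R)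
    (Q P : nat -> {poly R}) (S : R -> R) : Prop :=
  C1_on `[x 1%N, x N] S /\
  forall i t, (1 <= i < N)%N -> t \in `[x 1%N, x N] ->
    S (affine_map (a i) (b i) t) = ifs_F (alpha i) (ratfun (P i) (Q i)) t (S t).

(* Only the values of S on [x 1, x N] matter.  The cubic numerators P are not
   prescribed: they are constrained only by the join-up conditions. *)
Definition is_C1_rational_cubic_spline_FIF (R : realType) (N : nat)
    (x y d a b alpha : nat -> R) (Q : nat -> {poly R}) (S : R -> R) : Prop :=
  exists P : nat -> {poly R},
    [/\ forall i, (1 <= i < N)%N -> (size (P i) <= 4)%N,
        join_up N x y d a alpha Q P,
        is_C1_FIF N x a b alpha Q P S,
        forall i, (1 <= i <= N)%N -> S (x i) = y i &
        forall i, (1 <= i <= N)%N ->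
          has_deriv_within `[x 1%N, x N] S (x i) (d i)].

(* Main.v *)
(** The conditions on [F_i] and [F_{i,1}] are Hermite data for [P_i / Q_i] at
    the two endpoints, so they determine the cubic [P_i].  The derivative [g]
    of the spline must satisfy
    [g (L_i t) = (alpha_i g t + R_i' t) / a_i]; on continuous functions with
    endpoint values [d_1], [d_N] this prescribes a contraction of ratio
    [kappa], because [|alpha_i| <= kappa a_i].  Take [S] with [S' = g] and
    [S x_1 = y_1]: the defect [S o L_i - alpha_i S - R_i] is constant, equal to
    [e_i = S x_i - y_i], and evaluating it at [x_N] gives
    [e_{i+1} - e_i = alpha_i e_N].  Summing, [e_N = (sum_i alpha_i) e_N] with
    [|sum_i alpha_i| <= kappa sum_i a_i = kappa < 1], so all [e_i] vanish. *)

Require Import Defs.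
From HB Require Import structures.
From mathcomp Require Import all_boot all_order all_algebra.
From mathcomp Require Import all_classical all_reals all_analysis.
From mathcomp Require Import ring lra.
Import Order.TTheory GRing.Theory Num.Theory.
Import numFieldNormedType.Exports.
Local Open Scope classical_set_scope.
Local Open Scope ring_scope.

Set Implicit Arguments.
Unset Strict Implicit.
Unset Printing Implicit Defensive.

(** * Hermite interpolation by cubics and by quotients with fixed denominator *)

Lemma is_derive_ratfun {R : realType} (P Q : {poly R}) (t : R) :
  Q.[t] != 0 ->
  is_derive t 1 (ratfun P Q)
    ((P^`().[t] * Q.[t] - P.[t] * Q^`().[t]) / Q.[t] ^+ 2).
Proof.
move=> Qt.
have dQ := is_deriveV Qt (is_derive_poly Q t).
have dPQ := is_deriveM (is_derive_poly P t) dQ.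
apply: (is_derive_eq dPQ); rewrite /GRing.scale /=; by field.
Qed.

Lemma hermite_cubic_exists {R : realType} (u v p q p' q' : R) : u != v ->
  exists P : {poly R}, [/\ (size P <= 4)%N,
    P.[u] = p, P.[v] = q, P^`().[u] = p' & P^`().[v] = q'].
Proof.
move=> uv; have vu0 : v - u != 0 by rewrite subr_eq0 eq_sym.
(* The cubic is expanded in powers of ['X - u], so the data at [u] are its first two coefficients.
   With [s] the secant slope, [c2] and [c3] solve the two linear equations left by the data at
   [v]. *)
pose X := 'X - u%:P; pose s := (q - p) / (v - u).
pose c2 := (3 * s - 2 * p' - q') / (v - u).
pose c3 := (p' + q' - 2 * s) / (v - u) ^+ 2.
exists (p%:P + X * (p'%:P + X * (c2%:P + X * c3%:P))).
have sX (W : {poly R}) n : (size W <= n -> size (X * W)%R <= n.+1)%N.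
  move=> Wn; rewrite (leq_trans (size_polyMleq _ _))// size_XsubC.
  by rewrite addSn/= add1n ltnS.
have sC (c : R) (W : {poly R}) n :
    (size W <= n.+1 -> size (c%:P + W)%R <= n.+1)%N.
  move=> Wn; rewrite (leq_trans (size_polyD _ _))// geq_max Wn andbT.
  by rewrite (leq_trans (size_polyC_leq1 _)).
split.
- by do 3 apply/sC/sX; rewrite size_polyC_leq1.
- by rewrite /X !hornerE; ring.
- by rewrite /X !hornerE /c2 /c3 /s /=; field; rewrite vu0.
- by rewrite /X !poly.derivE !hornerE; ring.
- by rewrite /X !poly.derivE !hornerE /c2 /c3 /s /=; field; rewrite vu0.
Qed.

(** Both nodes are double roots, so four linear factors split off from [P]; its degree is at most 3,
    hence the remaining cofactor is zero. *)
Lemma hermite_cubic_eq0 {R : realType} (u v : R) (P : {poly R}) : u != v ->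
  (size P <= 4)%N -> P.[u] = 0 -> P.[v] = 0 -> P^`().[u] = 0 ->
  P^`().[v] = 0 -> P = 0.
Proof.
move=> uv sP Pu Pv P'u P'v.
have /factor_theorem[A PE] : root P u by apply/eqP.
have Au : root A u.
  by move/eqP: P'u; rewrite PE derivM derivXsubC !hornerE subrr mulr0 add0r.
have /factor_theorem[B AE] := Au.
have vu0 : v - u != 0 by rewrite subr_eq0 eq_sym.
have Bv : root B v.
  move: Pv; rewrite PE AE !hornerE => /eqP.
  by rewrite !mulf_eq0 (negbTE vu0) !orbF.
have /factor_theorem[C BE] := Bv.
have Cv : root C v.
  move: P'v; rewrite PE AE BE !derivM !derivXsubC !hornerE subrr !(mulr0, mul0r, addr0, add0r).
  by move=> /eqP; rewrite !mulf_eq0 (negbTE vu0) !orbF.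
have /factor_theorem[D CE] := Cv.
have D0 : D = 0; last by rewrite PE AE BE CE D0 !mul0r.
apply/eqP; apply: contraTT sP => D0; rewrite PE AE BE CE -ltnNge.
rewrite !size_Mmonic ?monicXsubC ?mulf_neq0 ?polyXsubC_eq0// !size_XsubC.
by rewrite !addn2 /= !ltnS lt0n size_poly_eq0.
Qed.

(** Clearing the denominator turns the conditions on the quotient into Hermite data for the
    numerator: value [p * Q] and slope [p' * Q + p * Q'] at [u], and likewise at [v]. *)
Lemma ratfun_hermite_exists {R : realType} (Q : {poly R}) (u v p q p' q' : R) :
  u != v -> Q.[u] != 0 -> Q.[v] != 0 ->
  exists P : {poly R}, [/\ (size P <= 4)%N,
    ratfun P Q u = p, ratfun P Q v = q,
    derive1 (ratfun P Q) u = p' & derive1 (ratfun P Q) v = q'].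
Proof.
move=> uv Qu Qv.
have [P [sP Pu Pv P'u P'v]] := hermite_cubic_exists (p * Q.[u]) (q * Q.[v])
  (p' * Q.[u] + p * Q^`().[u]) (q' * Q.[v] + q * Q^`().[v]) uv.
exists P; split => //; rewrite ?derive1E ?/ratfun ?Pu ?Pv ?mulfK//.
- have := is_derive_ratfun P Qu; move=> /@derive_val ->.
  by rewrite Pu P'u; field.
- have := is_derive_ratfun P Qv; move=> /@derive_val ->.
  by rewrite Pv P'v; field.
Qed.

(** Since [Q] does not vanish at the nodes, equal data for the quotients give equal data for the
    numerators, whose difference is then a cubic with zero Hermite data. *)
Lemma ratfun_hermite_unique {R : realType} (Q P P' : {poly R}) (u v : R) :
  u != v -> Q.[u] != 0 -> Q.[v] != 0 -> (size P <= 4)%N -> (size P' <= 4)%N ->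
  ratfun P Q u = ratfun P' Q u -> ratfun P Q v = ratfun P' Q v ->
  derive1 (ratfun P Q) u = derive1 (ratfun P' Q) u ->
  derive1 (ratfun P Q) v = derive1 (ratfun P' Q) v -> P = P'.
Proof.
move=> uv Qu Qv sP sP'.
have val t : Q.[t] != 0 -> ratfun P Q t = ratfun P' Q t -> P.[t] = P'.[t].
  by move=> Qt /mulIf; apply; rewrite invr_eq0.
have der t : Q.[t] != 0 -> P.[t] = P'.[t] ->
    derive1 (ratfun P Q) t = derive1 (ratfun P' Q) t ->
    P^`().[t] = P'^`().[t].
  move=> Qt Pt; rewrite !derive1E.
  rewrite (@derive_val _ _ _ _ _ _ _ (is_derive_ratfun P Qt)).
  rewrite (@derive_val _ _ _ _ _ _ _ (is_derive_ratfun P' Qt)) Pt.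
  move=> /mulIf /[!invr_eq0] /(_ (expf_neq0 _ Qt)) /addIr /mulIf; exact.
move=> /(val _ Qu) Pu /(val _ Qv) Pv /(der _ Qu Pu) P'u /(der _ Qv Pv) P'v.
apply/eqP; rewrite -subr_eq0; apply/eqP; apply: (hermite_cubic_eq0 uv).
- by rewrite (leq_trans (size_polyD _ _))// size_polyN geq_max sP.
- by rewrite !hornerE Pu subrr.
- by rewrite !hornerE Pv subrr.
- by rewrite derivB !hornerE P'u subrr.
- by rewrite derivB !hornerE P'v subrr.
Qed.

(** * Limits of function sequences and antiderivatives *)

Lemma geometric_pointwise_limit {R : realType} (G : nat -> R -> R) (M k : R) :
  0 <= k < 1 -> (forall n, continuous (G n)) ->
  (forall n u, `|G n.+1 u - G n u| <= M * k ^+ n) ->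
  exists g : R -> R, continuous g /\ forall u, G n u @[n --> \oo] --> g u.
Proof.
(* [C * k ^+ n] is the tail of the geometric series of bounds, so each bound [M * k ^+ n] is a
   difference of consecutive tails. *)
move=> /andP[k0 k1] cG dG; pose C := M / (1 - k).
have Mk n : M * k ^+ n = C * k ^+ n - C * k ^+ n.+1.
  by rewrite /C exprS; field; lra.
(* [G n u -+ C k^n] are monotone in [n], so both squeeze the limit. *)
have up u : {homo (fun n => G n u - C * k ^+ n) : n m / (n <= m)%N >-> n <= m}.
  apply/nondecreasing_seqP => n /=.
  by have := dG n u; rewrite Mk ler_norml => /andP[]; lra.
have down u : {homo (fun n => G n u + C * k ^+ n) : n m / (n <= m)%N >-> m <= n}.
  apply/nonincreasing_seqP => n /=.
  by have := dG n u; rewrite Mk ler_norml => /andP[]; lra.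
have C0 : 0 <= C.
  have := le_trans (normr_ge0 _) (dG 0 0); rewrite expr0 mulr1 => M0.
  by rewrite divr_ge0// subr_ge0 ltW.
have Ck0 n : 0 <= C * k ^+ n by rewrite mulr_ge0// exprn_ge0.
have k0cvg : C * k ^+ n @[n --> \oo] --> (0 : R).
  by have := @cvg_geometric R C k; rewrite ger0_norm//; exact.
have tail n m u : (n <= m)%N -> `|G m u - G n u| <= C * k ^+ n.
  move=> nm; have := up u _ _ nm; have := down u _ _ nm; have := Ck0 m.
  by rewrite ler_norml /= => ? ? ?; apply/andP; split; lra.
have cvgG u : cvgn (fun n => G n u).
  have : cvgn (fun n => G n u - C * k ^+ n).
    apply: nondecreasing_is_cvgn; first exact: up.
    exists (G 0%N u + C) => _ [n _ <-] /=.
    by have := tail 0%N n u isT; have := Ck0 n; rewrite ler_norml expr0; lra.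
  move=> cv; rewrite (_ : (fun n => G n u) =
    (fun n => G n u - C * k ^+ n) + (fun n => C * k ^+ n)); last first.
    by apply/funext => n; rewrite fctE subrK.
  exact: is_cvgD cv (cvgP _ k0cvg).
exists (fun u => limn (fun n => G n u)); split=> [|u]; last exact: cvgG.
(* The bound does not depend on [u]: convergence is uniform, and the usual three-epsilon argument
   carries continuity to the limit. *)
have lim_tail n u : `|limn (fun m => G m u) - G n u| <= C * k ^+ n.
  have : `|G m u - G n u| @[m --> \oo] --> `|limn (fun m => G m u) - G n u|.
    by apply: cvg_norm; apply: cvgB; [exact: cvgG|exact: cvg_cst].
  move=> /cvg_lim <- //; apply: limr_le.
    by apply: is_cvg_norm; apply: is_cvgB; [exact: cvgG|exact: is_cvg_cst].
  by near=> m; apply: tail; near: m; exact: nbhs_infty_ge.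
move=> u; apply/cvgrPdist_lt => e e0.
have e3 : 0 < e / 3 by rewrite divr_gt0.
have [n _ /(_ n (leqnn n))/=] := (cvgr0_norm_lt _ k0cvg) _ e3.
rewrite ger0_norm// => Cn.
have := cG n u; move=> /cvgrPdist_lt /(_ _ e3); apply: filterS => t Gt.
have := lim_tail n u; have := lim_tail n t.
move: Gt; rewrite !ltr_norml !ler_norml => /andP[? ?] /andP[? ?] /andP[? ?].
by apply/andP; split; lra.
Unshelve. all: by end_near. Qed.

Lemma continuous_antiderivative {R : realType} (g : R -> R) (u v y : R) :
  continuous g -> exists S : R -> R,
    S u = y /\ forall t, t \in `[u, v] -> is_derive t 1 S (g t).
Proof.
move=> cg.
(* The integration interval is widened by 1 on each side, so that [u] and [v] become interior points
   and [F] has a two-sided derivative there. *)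
pose F t := (\int[lebesgue_measure]_(s in `[u - 1, t]) g s)%R.
have dF t : t \in `[u, v] -> is_derive t 1 F (g t).
  rewrite in_itv/= => /andP[ut tv].
  have gi : lebesgue_measure.-integrable `[u - 1, v + 1] (EFin \o g).
    apply: continuous_compact_integrable; first exact: segment_compact.
    exact: continuous_subspaceT.
  have tv1 : t < v + 1 by lra.
  have ut1 : u - 1 < t by lra.
  have [dF Ft] := continuous_FTC1_closed tv1 gi ut1 (cg t).
  by split; [exact: dF|rewrite -derive1E].
exists (fun t => F t + (y - F u)); split=> [|t tuv]; first by rewrite addrC subrK.
have := is_deriveD (dF t tuv) (is_derive_cst (y - F u) t 1).
by rewrite addr0.
Qed.

(** * Derivatives relative to a set *)

Lemma is_derive_has_deriv_within {R : realType} (A : set R) (f : R -> R)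
    (t l : R) : is_derive t 1 f l -> has_deriv_within A f t l.
Proof.
move=> /is_derive1_caratheodory[h [fE ch <-]].
apply: (@cvg_trans _ ((f z - f t) / (z - t) @[z --> t^'])).
  apply: cvg_app; exact: cvg_within.
apply: (@cvg_trans _ (h z @[z --> t^'])).
  apply: near_eq_cvg; near=> z.
  rewrite fE mulfK// subr_eq0.
  by near: z; exact: nbhs_dnbhs_neq.
exact/continuous_withinNx.
Unshelve. all: by end_near. Qed.

(** Near [t], [f z] is the difference quotient times [z - t], plus [f t]; the product tends to 0.
    This gives the continuity of a competing spline, which is only known to be differentiable
    relative to the segment. *)
Lemma has_deriv_within_continuous {R : realType} (A : set R) (f : R -> R) :
  (forall t, A t -> exists l, has_deriv_within A f t l) ->
  {within A, continuous f}.
Proof.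
move=> df; apply/subspace_continuousP => t /df[l dft].
have fE : f z @[z --> within A t^'] --> f t.
  have zt : (z - t) @[z --> within A t^'] --> 0.
    rewrite -(subrr t); apply: cvgB; last exact: cvg_cst.
    by apply: (@cvg_trans _ t^'); exact: cvg_within.
  have : (f z - f t) / (z - t) * (z - t) + f t @[z --> within A t^'] -->
      l * 0 + f t.
    by apply: cvgD; [apply: cvgM; [exact: dft|exact: zt]|exact: cvg_cst].
  rewrite mulr0 add0r; apply: cvg_trans; apply: near_eq_cvg.
  near=> z => /=.
  have [->|zt0] := eqVneq z t; first by rewrite !subrr mulr0 add0r.
  by rewrite divfK ?subr_eq0// subrK.
apply/cvgrPdist_lt => e e0.
have /cvgrPdist_lt/(_ _ e0) := fE.
rewrite !near_withinE; apply: filterS => z H Az.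
have [->|zt0] := eqVneq z t; first by rewrite subrr normr0.
exact: H.
Unshelve. all: by end_near. Qed.

(** * Nodes, and the retraction of the line onto a segment *)

Lemma increasing_nodes {R : realType} (N : nat) (x : nat -> R) :
  (forall i, (1 <= i < N)%N -> x i < x i.+1) ->
  forall i j, (1 <= i)%N -> (i <= j <= N)%N -> x i <= x j.
Proof.
move=> hx i j i1; elim: j => [|j ih]; first by rewrite leqn0 => /andP[/eqP ->].
rewrite leq_eqVlt ltnS => /andP[/orP[/eqP ->//|ij] jN].
by rewrite (le_trans (ih _)) ?ij ?(ltnW jN)// ltW// hx// jN (leq_trans i1).
Qed.

Lemma nodes_cover {R : realType} (N : nat) (x : nat -> R) (t : R) :
  (2 <= N)%N -> x 1%N <= t <= x N ->
  exists2 i, (1 <= i < N)%N & x i <= t <= x i.+1.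
Proof.
elim: N => [//|[//|[|N] ih]] _ /andP[x1t txN].
  by exists 1%N => //; rewrite x1t.
have [tN|Nt] := leP t (x N.+2); last by exists N.+2; rewrite ?ltnSn// ltW.
have [|i /andP[i1 iN] xi] := ih isT; first by rewrite x1t.
by exists i; rewrite ?i1 ?(ltn_trans iN).
Qed.

(** This map retracts the line onto [[u, v]]; composing with it lets functions given on the segment
    be treated as continuous functions on the whole line. *)
Lemma continuous_clamp {R : realType} (u v : R) :
  continuous (fun t : R => Num.max u (Num.min t v)).
Proof.
move=> t; apply: (@continuous_max R R (cst u) (fun t => Num.min t v)).
  exact: cvg_cst.
by apply: (@continuous_min R R id (cst v)); [exact: cvg_id|exact: cvg_cst].
Qed.

Lemma clamp_itv {R : realType} (u v t : R) : u <= v ->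
  Num.max u (Num.min t v) \in `[u, v].
Proof.
by move=> uv; rewrite in_itv/= le_max lexx ge_max uv ge_min lexx orbT.
Qed.

Lemma clamp_le {R : realType} (u v t : R) : t <= u -> u <= v ->
  Num.max u (Num.min t v) = u.
Proof. by move=> tu uv; apply/max_idPl; rewrite ge_min tu. Qed.

Lemma clamp_ge {R : realType} (u v t : R) : v <= t -> u <= v ->
  Num.max u (Num.min t v) = v.
Proof. by move=> vt uv; rewrite (min_idPr vt); exact/max_idPr. Qed.

Lemma clamp_id {R : realType} (u v t : R) : t \in `[u, v] ->
  Num.max u (Num.min t v) = t.
Proof.
by rewrite in_itv/= => /andP[ut tv]; rewrite (min_idPl tv); exact/max_idPr.
Qed.

(** * The derivative as fixed point of a contraction *)

Lemma derivative_fixed_point {R : realType} (N : nat)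
    (x d a b alpha : nat -> R) (r : nat -> R -> R) (kappa : R) :
  (2 <= N)%N -> (forall i, (1 <= i < N)%N -> x i < x i.+1) ->
  (forall i, (1 <= i < N)%N ->
     a i * x 1%N + b i = x i /\ a i * x N + b i = x i.+1) ->
  0 <= kappa < 1 ->
  (forall i, (1 <= i < N)%N -> `|alpha i| <= kappa * a i) ->
  (forall i t, (1 <= i < N)%N -> t \in `[x 1%N, x N] ->
     {for t, continuous (r i)}) ->
  (forall i, (1 <= i < N)%N -> (alpha i * d 1%N + r i (x 1%N)) / a i = d i) ->
  (forall i, (1 <= i < N)%N -> (alpha i * d N + r i (x N)) / a i = d i.+1) ->
  exists g : R -> R, [/\ continuous g, g (x 1%N) = d 1%N, g (x N) = d N &
    forall i t, (1 <= i < N)%N -> t \in `[x 1%N, x N] ->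
      g (a i * t + b i) = (alpha i * g t + r i t) / a i].
Proof.
move=> hN hx hL /andP[k0 k1] halpha cr r1 rN.
have hmono := increasing_nodes hx.
have x1N : x 1%N < x N.
  have h1 : (1 <= 1 < N)%N by rewrite hN.
  by rewrite (lt_le_trans (hx _ h1))// hmono// hN leqnn.
have x1N' := ltW x1N.
have x1I : x 1%N \in `[x 1%N, x N] by rewrite in_itv/= lexx.
have xNI : x N \in `[x 1%N, x N] by rewrite in_itv/= lexx andbT.
have a0 i : (1 <= i < N)%N -> 0 < a i.
  move=> hi; have [L1 LN] := hL i hi; have xi := hx i hi.
  have : 0 < a i * (x N - x 1%N) by rewrite mulrBr; lra.
  by rewrite pmulr_lgt0// subr_gt0.
pose cl t := Num.max (x 1%N) (Num.min t (x N)).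
have clI t : cl t \in `[x 1%N, x N] by exact: clamp_itv.
have ccl : continuous cl by exact: continuous_clamp.
pose h i (g : R -> R) t := (alpha i * g t + r i t) / a i.
(* Writing the piecewise definition [T g (L_i t) = h i g t] as a sum of clamped
   increments makes the continuity of [T g] immediate: on the [j]-th subinterval
   the earlier terms are frozen at [d i.+1 - d i] and the later ones at [0]. *)
pose T (g : R -> R) u := d 1%N +
  \sum_(1 <= i < N) (h i g (cl ((cl u - b i) / a i)) - h i g (x 1%N)).
(* The endpoint values make consecutive pieces agree at the nodes: [h i g (x N)] and
   [h i.+1 g (x 1)] are then both [d i.+1]. *)
pose good g := [/\ continuous g, g (x 1%N) = d 1%N & g (x N) = d N].
have hx1 i g : (1 <= i < N)%N -> good g -> h i g (x 1%N) = d i.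
  by move=> hi [_ g1 _]; rewrite /h g1 r1.
have hxN i g : (1 <= i < N)%N -> good g -> h i g (x N) = d i.+1.
  by move=> hi [_ _ gN]; rewrite /h gN rN.
have LI i t : (1 <= i < N)%N -> t \in `[x 1%N, x N] ->
    x i <= a i * t + b i <= x i.+1.
  move=> hi; rewrite in_itv/= => /andP[t1 tN]; have [<- <-] := hL i hi.
  by rewrite !lerD2r !ler_pM2l ?a0// t1.
have IL i u : (1 <= i < N)%N -> x i <= u <= x i.+1 ->
    (u - b i) / a i \in `[x 1%N, x N].
  move=> hi; have [<- <-] := hL i hi => /andP[u1 uN].
  rewrite in_itv/= ler_pdivlMr ?a0// ler_pdivrMr ?a0//.
  by apply/andP; split; lra.
have TL g i t : good g -> (1 <= i < N)%N -> t \in `[x 1%N, x N] ->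
    T g (a i * t + b i) = h i g t.
  move=> gg hi tI; have /andP[i1 iN] := hi.
  have /andP[u1 u2] := LI i t hi tI; set u := a i * t + b i in u1 u2 *.
  have uI : u \in `[x 1%N, x N].
    rewrite in_itv/=; apply/andP; split.
      by apply: le_trans u1; apply: hmono => //; rewrite i1 ltnW.
    by apply: (le_trans u2); apply: hmono => //; rewrite iN leqnn.
  (* The sum is cut at [i]. For later maps the preimage of [u] lies left of [x 1] and is clamped to
     it; for earlier maps it lies right of [x N] and is clamped there. *)
  rewrite /T [cl u]clamp_id// (@big_cat_nat _ _ _ i) ?(ltnW iN)//=.
  rewrite [in X in _ + (_ + X)]big_ltn//.
  rewrite [in X in _ + (_ + (_ + X))]big1_seq ?addr0; last first.
    move=> j; rewrite mem_index_iota => /andP[_ /andP[ij jN]].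
    have hj : (1 <= j < N)%N by rewrite jN (ltn_trans i1).
    have uj : (u - b j) / a j <= x 1%N.
      rewrite ler_pdivrMr ?a0// lerBlDr mulrC (hL j hj).1.
      by apply: (le_trans u2); apply: hmono => //; rewrite ij ltnW.
    by rewrite [cl _]clamp_le// subrr.
  have -> : \sum_(1 <= j < i) (h j g (cl ((u - b j) / a j)) - h j g (x 1%N)) =
            \sum_(1 <= j < i) (d j.+1 - d j).
    apply: eq_big_nat => j /andP[j1 ji].
    have hj : (1 <= j < N)%N by rewrite j1 (ltn_trans ji).
    have uj : x N <= (u - b j) / a j.
      rewrite ler_pdivlMr ?a0// lerBrDr mulrC (hL j hj).2.
      by apply: le_trans u1; apply: hmono => //; rewrite ji ltnW.
    by rewrite (hx1 j)// [cl _]clamp_ge// (hxN j).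
  rewrite telescope_sumr// (hx1 i)// /u addrK mulrAC divff ?mul1r ?gt_eqF ?a0//.
  by rewrite [cl t]clamp_id//; ring.
have Tcover u : exists i t, [/\ (1 <= i < N)%N, t \in `[x 1%N, x N] &
    cl u = a i * t + b i].
  have := clI u; rewrite in_itv/= => /(nodes_cover hN)[i hi ui].
  exists i, ((cl u - b i) / a i); split => //; first exact: IL.
  by rewrite mulrC divfK ?subrK// gt_eqF// a0.
have Tcl g u : T g u = T g (cl u) by rewrite /T [cl (cl u)]clamp_id.
have ch i g : (1 <= i < N)%N -> continuous g -> continuous (h i g \o cl).
  move=> hi cg t; apply: continuous_comp; first exact: ccl.
  apply: cvgM; last exact: cvg_cst.
  by apply: cvgD; [apply: cvgM; [exact: cvg_cst|exact: cg]|exact: cr].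
have goodT g : good g -> good (T g).
  move=> gg; split.
  - have cT t : \sum_(1 <= i < N) (h i g (cl ((cl u - b i) / a i)) - h i g (x 1%N))
        @[u --> t] -->
        \sum_(1 <= i < N) (h i g (cl ((cl t - b i) / a i)) - h i g (x 1%N)).
      under eq_fun do rewrite big_nat; rewrite big_nat.
      apply: cvg_big => [|i hi]; first exact: add_continuous.
      apply: cvgB; last exact: cvg_cst.
      apply: (@continuous_comp _ _ _ (fun u => (cl u - b i) / a i) (h i g \o cl)).
        apply: cvgM; last exact: cvg_cst.
        by apply: cvgB; [exact: ccl|exact: cvg_cst].
      by apply: ch => //; case: gg.
    by move=> t; apply: cvgD; [exact: cvg_cst|exact: cT].
  - have h1 : (1 <= 1 < N)%N by rewrite hN.
    by rewrite -[in LHS](hL _ h1).1 TL// hx1.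
  (* The right endpoint is reached through the last map, which has index [N.-1]. *)
  - have hN1 : (1 <= N.-1 < N)%N by case: (N) hN => [|[]]//= n _; rewrite ltnSn.
    have NE : N.-1.+1 = N by rewrite prednK// ltnW.
    have := (hL _ hN1).2; rewrite NE => <-.
    by rewrite TL// (hxN _ _ hN1)// NE.
(* The iteration starts from the affine interpolant of the two endpoint values, extended by
   constants. *)
pose G0 u := d 1%N + (d N - d 1%N) / (x N - x 1%N) * (cl u - x 1%N).
have good0 : good G0.
  split.
  - move=> t; apply: cvgD; first exact: cvg_cst.
    apply: cvgM; first exact: cvg_cst.
    by apply: cvgB; [exact: ccl|exact: cvg_cst].
  - by rewrite /G0 [cl _]clamp_id// subrr mulr0 addr0.
  - rewrite /G0 [cl _]clamp_id// divfK ?subrKC// gt_eqF// subr_gt0//.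
pose G n := iter n T G0.
have goodG n : good (G n) by elim: n => //= n /goodT.
(* On the [i]-th piece the terms [r i] cancel, leaving the factor [alpha i / a i], of modulus at
   most [kappa]. *)
have contr g g' K : good g -> good g' -> (forall u, `|g u - g' u| <= K) ->
    forall u, `|T g u - T g' u| <= kappa * K.
  move=> gg gg' gK u; have [i [t [hi tI uE]]] := Tcover u.
  rewrite Tcl (Tcl g') uE !TL// /h.
  rewrite -mulrBl opprD addrACA subrr addr0 -mulrBr normrM normfV (gtr0_norm (a0 _ hi)).
  rewrite ler_pdivrMr ?a0// normrM mulrAC ler_pM//; exact: halpha.
(* [T G0 - G0] factors through [cl], so its maximum over the compact segment bounds it on the whole
   line. *)
have [M hM] : exists M, forall u, `|T G0 u - G0 u| <= M.
  have [c _ hc] : exists2 c, c \in `[x 1%N, x N] & forall t,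
      t \in `[x 1%N, x N] -> `|T G0 t - G0 t| <= `|T G0 c - G0 c|.
    apply: EVT_max => //; apply: continuous_subspaceT => t.
    have [c1 _ _] := goodT _ good0; have [c2 _ _] := good0.
    by apply: cvg_norm; apply: cvgB; [exact: c1|exact: c2].
  exists (`|T G0 c - G0 c|) => u.
  by rewrite Tcl (_ : G0 u = G0 (cl u)) ?hc// /G0 [cl (cl u)]clamp_id.
have dG n u : `|G n.+1 u - G n u| <= M * kappa ^+ n.
  elim: n u => [|n ih] u; first by rewrite expr0 mulr1; exact: hM.
  by rewrite exprS mulrCA; exact: contr (goodG n.+1) (goodG n) ih _.
have [|n|g [cg Gg]] := @geometric_pointwise_limit _ G M kappa _ _ dG.
- by rewrite k0.
- by have [] := goodG n.
have glim u c : (forall n, G n u = c) -> g u = c.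
  move=> Gc; have := Gg u; rewrite (_ : (fun n => G n u) = fun=> c).
    by move=> /cvg_unique; apply => //; exact: cvg_cst.
  by apply/funext.
exists g; split => //.
- by apply: glim => n; have [] := goodG n.
- by apply: glim => n; have [] := goodG n.
- move=> i t hi tI.
  (* Both sides of [G n.+1 (L_i t) = h i (G n) t] are passed to the limit. *)
  have Gs : G n.+1 (a i * t + b i) @[n --> \oo] --> g (a i * t + b i).
    by rewrite (cvg_shiftS (fun n => G n (a i * t + b i))); exact: Gg.
  apply: (cvg_unique _ Gs) => //.
  rewrite (_ : (fun n => G n.+1 _) = fun n => h i (G n) t); last first.
    by apply/funext => n; exact: TL (goodG n) hi tI.
  apply: cvgM; last exact: cvg_cst.
  by apply: cvgD; [apply: cvgM; [exact: cvg_cst|exact: Gg]|exact: cvg_cst].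
Qed.

(** * Constancy, and uniqueness for the functional equation *)

Lemma is_derive0_segment_cst {R : realType} (f : R -> R) (u v t : R) :
  (forall s, s \in `[u, v] -> is_derive s 1 f 0) -> t \in `[u, v] -> f t = f u.
Proof.
move=> df tuv; have /andP[ut tv] : u <= t <= v by move: tuv; rewrite in_itv.
have sub s : s \in `[u, t] -> s \in `[u, v].
  by rewrite !in_itv/= => /andP[-> /le_trans ->].
have dsub s : s \in `]u, t[ -> is_derive s 1 f 0.
  by move=> sut; apply/df/sub; exact: subset_itv_oo_cc.
have cf : {within `[u, t], continuous f}.
  by apply: derivable_within_continuous => s sut; have [] := df s (sub s sut).
have [c _] := @MVT_segment _ f (fun=> 0) u t ut dsub cf.
by rewrite mul0r => /eqP; rewrite subr_eq0 => /eqP.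
Qed.

Lemma is_derive_affine {R : realType} (a b t : R) :
  is_derive t 1 (fun s => a * s + b) a.
Proof.
have := is_deriveD (is_deriveZ a (is_derive_id t 1)) (is_derive_cst b t 1).
by rewrite /GRing.scale /= mulr1 addr0.
Qed.

(** Let [|T - S|] be maximal at [c], and write [c] as the image of some [t] under a map [L_i].
    Subtracting the two equations cancels [r i], so the maximum is at most [kappa] times itself,
    hence zero. *)
Lemma fractal_equation_unique {R : realType} (N : nat)
    (x a b alpha : nat -> R) (r : nat -> R -> R) (kappa : R) (S T : R -> R) :
  (2 <= N)%N -> (forall i, (1 <= i < N)%N -> x i < x i.+1) ->
  (forall i, (1 <= i < N)%N ->
     a i * x 1%N + b i = x i /\ a i * x N + b i = x i.+1) ->
  kappa < 1 -> (forall i, (1 <= i < N)%N -> `|alpha i| <= kappa) ->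
  {within `[x 1%N, x N], continuous S} ->
  {within `[x 1%N, x N], continuous T} ->
  (forall i t, (1 <= i < N)%N -> t \in `[x 1%N, x N] ->
     S (a i * t + b i) = alpha i * S t + r i t) ->
  (forall i t, (1 <= i < N)%N -> t \in `[x 1%N, x N] ->
     T (a i * t + b i) = alpha i * T t + r i t) ->
  {in `[x 1%N, x N], T =1 S}.
Proof.
move=> hN hx hL k1 halpha cS cT eS eT.
have x1N : x 1%N <= x N by apply: (increasing_nodes hx); rewrite // leqnn ltnW.
have [|c cI cmax] := @EVT_max _ (fun t => `|T t - S t|) _ _ x1N.
  by move=> t; apply: cvg_norm; apply: cvgB; [exact: cT|exact: cS].
suff c0 : `|T c - S c| <= 0.
  move=> t tI; apply/eqP; rewrite -subr_eq0 -normr_le0.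
  exact: le_trans (cmax t tI) c0.
have := cI; rewrite in_itv/= => /(nodes_cover hN)[i hi ci].
have [L1 LN] := hL i hi; have xi := hx i hi.
have a0 : 0 < a i.
  have : 0 < a i * (x N - x 1%N) by rewrite mulrBr; lra.
  by rewrite pmulr_lgt0// subr_gt0 lt_neqAle x1N andbT; case: eqP L1 LN => // ->; lra.
pose t := (c - b i) / a i.
have tI : t \in `[x 1%N, x N].
  rewrite in_itv/= ler_pdivlMr// ler_pdivrMr//.
  by apply/andP; split; lra.
have cE : c = a i * t + b i by rewrite /t mulrC divfK ?subrK// gt_eqF.
have : `|T c - S c| <= kappa * `|T c - S c|.
  rewrite {1 2}cE eT// eS// opprD addrACA subrr addr0 -mulrBr normrM.
  by apply: ler_pM => //; [exact: halpha|exact: cmax].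
by have := normr_ge0 (T c - S c); nra.
Qed.

(** * Existence and uniqueness of the spline *)

Theorem theorem3p1 (R : realType) (N : nat) (x y d a b : nat -> R)
    (kappa : R) (alpha : nat -> R) (Q : nat -> {poly R})
    (hN : (2 <= N)%N)
    (hx : forall i, (1 <= i < N)%N -> x i < x i.+1)
    (hL : forall i, (1 <= i < N)%N ->
      affine_map (a i) (b i) (x 1%N) = x i /\
      affine_map (a i) (b i) (x N) = x i.+1)
    (hkappa : 0 <= kappa < 1)
    (halpha : forall i, (1 <= i < N)%N -> `|alpha i| <= kappa * a i)
    (hQ2 : forall i, (1 <= i < N)%N -> (size (Q i) <= 3)%N)
    (hQ0 : forall i t, (1 <= i < N)%N -> t \in `[x 1%N, x N] ->
      (Q i).[t] != 0) :
  exists S : R -> R,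
    is_C1_rational_cubic_spline_FIF N x y d a b alpha Q S /\
    forall T : R -> R,
      is_C1_rational_cubic_spline_FIF N x y d a b alpha Q T ->
      {in `[x 1%N, x N], T =1 S}.
Proof.
have /andP[k0 k1] := hkappa.
have hmono := increasing_nodes hx.
have x1N : x 1%N < x N.
  have h1 : (1 <= 1 < N)%N by rewrite hN.
  by rewrite (lt_le_trans (hx _ h1))// hmono// hN leqnn.
have x1N0 : x 1%N != x N by rewrite lt_eqF.
have x1I : x 1%N \in `[x 1%N, x N] by rewrite in_itv/= lexx ltW.
have xNI : x N \in `[x 1%N, x N] by rewrite in_itv/= lexx ltW.
have aE i : (1 <= i < N)%N -> a i = (x i.+1 - x i) / (x N - x 1%N).
  move=> hi; have [<- <-] := hL i hi; rewrite /affine_map; field.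
  by rewrite subr_eq0 eq_sym.
have a0 i : (1 <= i < N)%N -> 0 < a i.
  by move=> hi; rewrite aE// divr_gt0// subr_gt0// hx.
have a0' i : (1 <= i < N)%N -> a i != 0 by move=> /a0 /lt0r_neq0.
(* Each subinterval is no longer than the whole segment; this turns the bound [kappa * a i] into the
   bound [kappa] required for comparing two splines. *)
have a1 i : (1 <= i < N)%N -> a i <= 1.
  move=> hi; have /andP[i1 iN] := hi.
  rewrite aE// ler_pdivrMr ?subr_gt0// mul1r lerB//.
    by apply: hmono; rewrite // iN leqnn.
  by apply: hmono; rewrite // i1 ltnW.
have alphak i : (1 <= i < N)%N -> `|alpha i| <= kappa.
  by move=> hi; rewrite (le_trans (halpha i hi))// ler_piMr// a1.
(* These are the join-up conditions solved for the values and slopes of [P / Q i]. Outside the index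
   range the choice defaults to [0]. *)
have /choice[P HP] : forall i, exists P : {poly R}, (1 <= i < N)%N ->
    [/\ (size P <= 4)%N,
      ratfun P (Q i) (x 1%N) = y i - alpha i * y 1%N,
      ratfun P (Q i) (x N) = y i.+1 - alpha i * y N,
      derive1 (ratfun P (Q i)) (x 1%N) = a i * d i - alpha i * d 1%N &
      derive1 (ratfun P (Q i)) (x N) = a i * d i.+1 - alpha i * d N].
  move=> i; have [hi|hi] := boolP (1 <= i < N)%N; last by exists 0.
  have [P HP] := ratfun_hermite_exists (y i - alpha i * y 1%N)
    (y i.+1 - alpha i * y N) (a i * d i - alpha i * d 1%N)
    (a i * d i.+1 - alpha i * d N) x1N0 (hQ0 _ _ hi x1I) (hQ0 _ _ hi xNI).
  by exists P.
pose r i := ratfun (P i) (Q i).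
(* The quotient rule written out, so that continuity on the segment can be read off; there it agrees
   with [derive1 (r i)]. *)
pose r1 i t := ((P i)^`().[t] * (Q i).[t] - (P i).[t] * (Q i)^`().[t]) /
  (Q i).[t] ^+ 2.
have dr i t : (1 <= i < N)%N -> t \in `[x 1%N, x N] ->
    is_derive t 1 (r i) (r1 i t).
  by move=> hi tI; apply: is_derive_ratfun; exact: hQ0.
have drE i t : (1 <= i < N)%N -> t \in `[x 1%N, x N] -> derive1 (r i) t = r1 i t.
  by move=> hi tI; rewrite derive1E; have [_ ->] := dr i t hi tI.
have cr1 i t : (1 <= i < N)%N -> t \in `[x 1%N, x N] ->
    {for t, continuous (r1 i)}.
  move=> hi tI; apply: cvgM.
    by apply: cvgB; apply: cvgM; exact: continuous_horner.
  apply: cvgV; first by rewrite expf_neq0// hQ0.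
  by apply: (@continuous_comp _ _ _ (horner (Q i)) (fun z => z ^+ 2));
    [exact: continuous_horner|exact: exprn_continuous].
have joinP i : (1 <= i < N)%N ->
    (alpha i * d 1%N + r1 i (x 1%N)) / a i = d i /\
    (alpha i * d N + r1 i (x N)) / a i = d i.+1.
  move=> hi; have [_ _ _ du dv] := HP i hi.
  by rewrite -!drE// /r du dv !subrKC !(mulrC (a i)) !mulfK ?a0'.
have [g [cg g1 gN gL]] := @derivative_fixed_point _ N x d a b alpha r1 kappa
  hN hx hL hkappa halpha cr1 (fun i hi => (joinP i hi).1)
  (fun i hi => (joinP i hi).2).
have [S [S1 dS]] := continuous_antiderivative (x 1%N) (x N) (y 1%N) cg.
have LI i t : (1 <= i < N)%N -> t \in `[x 1%N, x N] ->
    a i * t + b i \in `[x 1%N, x N].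
  move=> hi; have /andP[i1 iN] := hi; rewrite !in_itv/= => /andP[t1 tN].
  have [L1 LN] := hL i hi; apply/andP; split.
    have /le_trans -> // : x 1%N <= x i by apply: hmono; rewrite // i1 ltnW.
    by rewrite -L1 /affine_map lerD2r ler_pM2l// a0.
  have /(le_trans _) -> // : x i.+1 <= x N by apply: hmono; rewrite // iN leqnn.
  by rewrite -LN /affine_map lerD2r ler_pM2l// a0.
have SL i t : (1 <= i < N)%N -> t \in `[x 1%N, x N] ->
    S (a i * t + b i) - alpha i * S t - r i t = S (x i) - y i.
  move=> hi tI.
  (* The derivative of this defect at [s] is [a i * g (L_i s) - alpha i * g s - r1 i s], which
     vanishes by the equation for [g]; its value at [x 1] is [S (x i) - y i]. *)
  pose f := S \o (fun s => a i * s + b i) - alpha i *: S - r i.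
  have /is_derive0_segment_cst -/(_ _ tI) : forall s, s \in `[x 1%N, x N] ->
      is_derive s 1 f 0.
    move=> s sI; have dSL := @is_derive1_comp _ S (fun s => a i * s + b i) _ _ _
      (dS _ (LI i s hi sI)) (is_derive_affine (a i) (b i) s).
    have df := is_deriveB (is_deriveB dSL (is_deriveZ (alpha i) (dS s sI)))
      (dr i s hi sI).
    apply: (is_derive_eq df); rewrite gL// divfK ?a0'// /GRing.scale /=.
    by ring.
  rewrite /f !fctE /= /GRing.scale /= => ->.
  have [_ + _ _ _] := HP i hi; rewrite -/(r i) => ->.
  have [+ _] := hL i hi; rewrite /affine_map => ->; rewrite S1.
  by ring.
pose e i := S (x i) - y i.
have eS i : (1 <= i < N)%N -> e i.+1 - e i = alpha i * e N.
  move=> hi; have := SL i (x N) hi xNI; have [_ _ + _ _] := HP i hi.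
  rewrite -/(r i) => ->; have [_ +] := hL i hi; rewrite /affine_map => -> H.
  by rewrite /e -H; ring.
have e1 : e 1%N = 0 by rewrite /e S1 subrr.
have eN : e N = 0.
  have h : e N = (\sum_(1 <= i < N) alpha i) * e N.
    transitivity (\sum_(1 <= i < N) (e i.+1 - e i)).
      by rewrite telescope_sumr 1?ltnW// e1 subr0.
    by rewrite mulr_suml; apply: eq_big_nat => i /eS.
  have A1 : `|\sum_(1 <= i < N) alpha i| <= kappa.
    apply: (le_trans (ler_norm_sum _ _ _)).
    rewrite (@le_trans _ _ (\sum_(1 <= i < N) kappa * a i))//.
      by apply: ler_sum_nat => i; exact: halpha.
    (* The ratios [a i] sum to 1, because the subinterval lengths add up to [x N - x 1]. *)
    rewrite -mulr_sumr (eq_big_nat _ _ aE) -mulr_suml telescope_sumr 1?ltnW//.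
    by rewrite divff ?mulr1// subr_eq0 eq_sym.
  apply/eqP; rewrite -normr_le0.
  have : `|e N| <= kappa * `|e N| by rewrite {1}h normrM ler_wpM2r.
  by have := normr_ge0 (e N); nra.
have e0 i : (1 <= i <= N)%N -> e i = 0.
  elim: i => // -[_ _|i ih /andP[_ iN]]; first exact: e1.
  have := eS i.+1; rewrite ih; last exact: ltnW.
  by rewrite iN eN mulr0 subr0; exact.
have cS : {within `[x 1%N, x N], continuous S}.
  by apply: derivable_within_continuous => t tI; have [] := dS t tI.
have SE i t : (1 <= i < N)%N -> t \in `[x 1%N, x N] ->
    S (a i * t + b i) = alpha i * S t + r i t.
  move=> hi tI; have /andP[i1 iN] := hi; have := SL i t hi tI.
  have -> : S (x i) - y i = 0 by apply: e0; rewrite i1 ltnW.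
  by move=> /eqP; rewrite subr_eq0 subr_eq [r i t + _]addrC => /eqP.
exists S; split.
  exists P; split.
  - by move=> i hi; have [] := HP i hi.
  - move=> i hi; have [_ Pu Pv _ _] := HP i hi; have [du dv] := joinP i hi.
    by split; rewrite /ifs_F /ifs_F1 ?Pu ?Pv ?subrKC// -/(r i) drE.
  - split=> [|i t hi tI]; last exact: SE.
    exists g; last exact: continuous_subspaceT.
    by move=> t tI; apply: is_derive_has_deriv_within; exact: dS.
  - by move=> i hi; apply/eqP; rewrite -subr_eq0; apply/eqP; exact: e0.
  - move=> i /andP[i1 iN].
    have xiI : x i \in `[x 1%N, x N].
      by rewrite in_itv/= !hmono ?i1 ?iN ?leqnn.
    (* For [i < N] the node is the image of [x 1] under [L_i], where [g] is given by the join-up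
       condition; the last node starts no subinterval and uses the endpoint value of [g]. *)
    have <- : g (x i) = d i.
      move: iN; rewrite leq_eqVlt => /predU1P[->//|iN].
      have hi : (1 <= i < N)%N by rewrite i1.
      by have := gL i _ hi x1I; rewrite [LHS](congr1 g (hL i hi).1) g1 (joinP i hi).1.
    by apply: is_derive_has_deriv_within; exact: dS.
move=> T [P' [sP' jP' [[T1 dT _] TE] _ _]].
(* A competitor comes with its own numerators. The join-up conditions force them to be [P], so both
   splines solve the same functional equation. *)
have PP' i : (1 <= i < N)%N -> P' i = P i.
  move=> hi; have [Pu' Pv' du' dv'] := jP' i hi; have [sP Pu Pv du dv] := HP i hi.
  have D (p q c : R) : (p + q) / a i = c -> q = a i * c - p.
    by move=> <-; rewrite mulrC divfK ?a0'//; ring.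
  apply: (ratfun_hermite_unique x1N0 (hQ0 _ _ hi x1I) (hQ0 _ _ hi xNI)) => //.
  - exact: sP'.
  - by rewrite Pu -Pu' /ifs_F; ring.
  - by rewrite Pv -Pv' /ifs_F; ring.
  - by rewrite du; exact: D.
  - by rewrite dv; exact: D.
apply: (fractal_equation_unique hN hx hL k1 alphak cS _ SE).
  by apply: has_deriv_within_continuous => t tI; exists (T1 t); exact: dT.
by move=> i t hi tI; rewrite /r -PP'//; exact: TE.
Qed.
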